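(* For integers $n,j\ge 0$ let $s_{n,j}$ be the number of partial decorated Dyck paths consisting of $n$ steps and ending on level $j$, and let $S(z,u)=\sum_{n\ge0}\sum_{j\ge0}s_{n,j}z^nu^j$. Then $$S(z,u)=\frac{3-3z^2-\sqrt{1-6z^2+5z^4}}{2zr_1(1-u/r_1)},\qquad\text{with}\qquad r_1=\frac{1+z^2+\sqrt{1-6z^2+5z^4}}{2z}.$$ Furthermore, for every $j\ge0$, $$[u^j]S(z,u)=\frac{3-3z^2-\sqrt{1-6z^2+5z^4}}{2zr_1^{j+1}}.$$
   Context: A partial decorated Dyck path is a finite (possibly empty) sequence of steps starting at level $0$, where each step is an up-step $(1,1)$ (raising the level by 1), a black down-step $(1,-1)$, or a red down-step $(1,-1)$ (each lowering the level by 1), such that: the level never becomes negative; an up-step is never immediately followed by a red down-step; and a red down-step is never immediately followed by an up-step. Its end level is the level reached after its last step (level $0$ for the empty path). $[u^j]$ denotes extraction of the coefficient of $u^j$. The identities are between formal power series; $\sqrt{1-6z^2+5z^4}$ is the power series square root with constant term $1$. Thus $zr_1$ is a power series in $z$ with constant term $1$, and $1/r_1=z/(zr_1)$ is a power series in $z$ with zero constant term. *)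

(* Defs.v *)
From HB Require Import structures.
From mathcomp Require Import all_boot all_order all_algebra.
From mathcomp Require Import boolp classical_sets.

Set Implicit Arguments.
Unset Strict Implicit.
Unset Printing Implicit Defensive.

Import Order.TTheory GRing.Theory Num.Theory.
Local Open Scope ring_scope.

Record fps (R : Type) : Type := FPS { fps_coef : nat -> R }.

Notation "{ 'fps' R }" := (fps R) (at level 0, format "{ 'fps'  R }") : type_scope.

Lemma fpsP (R : Type) (f g : {fps R}) :
  (forall n, fps_coef f n = fps_coef g n) <-> f = g.
Proof. by split=> [|-> //]; case: f g => [f] [g] /= /funext ->. Qed.

HB.instance Definition _ (R : Type) := gen_eqMixin {fps R}.
HB.instance Definition _ (R : Type) := gen_choiceMixin {fps R}.

Section Zmodule.
Context (R : zmodType).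
Implicit Types f g h : {fps R}.

Definition fps_zero : {fps R} := FPS (fun=> 0).
Definition fps_opp f : {fps R} := FPS (fun n => - fps_coef f n).
Definition fps_add f g : {fps R} := FPS (fun n => fps_coef f n + fps_coef g n).

Fact fps_addA : associative fps_add.
Proof. by move=> f g h; apply/fpsP => n /=; rewrite addrA. Qed.
Fact fps_addC : commutative fps_add.
Proof. by move=> f g; apply/fpsP => n /=; rewrite addrC. Qed.
Fact fps_add0 : left_id fps_zero fps_add.
Proof. by move=> f; apply/fpsP => n /=; rewrite add0r. Qed.
Fact fps_addN : left_inverse fps_zero fps_opp fps_add.
Proof. by move=> f; apply/fpsP => n /=; rewrite addNr. Qed.

HB.instance Definition _ := GRing.isZmodule.Build {fps R}
  fps_addA fps_addC fps_add0 fps_addN.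

Lemma fps_coef0 n : fps_coef (0 : {fps R}) n = 0. Proof. by []. Qed.
Lemma fps_coefD f g n : fps_coef (f + g) n = fps_coef f n + fps_coef g n.
Proof. by []. Qed.
Lemma fps_coefN f n : fps_coef (- f) n = - fps_coef f n. Proof. by []. Qed.
Lemma fps_coefB f g n : fps_coef (f - g) n = fps_coef f n - fps_coef g n.
Proof. by []. Qed.

End Zmodule.

Definition fpsC (R : zmodType) (c : R) : {fps R} :=
  FPS (fun n => if n == 0%N then c else 0).

Section ComRing.
Context (R : comNzRingType).
Implicit Types f g h : {fps R}.

Definition fps_mul f g : {fps R} :=
  FPS (fun n => \sum_(i < n.+1) fps_coef f i * fps_coef g (n - i)).

Fact fps_coef_mul_rev f g n : fps_coef (fps_mul f g) n =
  \sum_(i < n.+1) fps_coef f (n - i) * fps_coef g i.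
Proof.
rewrite /= (reindex_inj rev_ord_inj) /=; apply: eq_bigr => i _.
by rewrite subSS subKn // -ltnS.
Qed.

Fact fps_mulC : commutative fps_mul.
Proof.
move=> f g; apply/fpsP => n; rewrite fps_coef_mul_rev /=.
by apply: eq_bigr => i _; rewrite mulrC.
Qed.

Fact fps_mulA : associative fps_mul.
Proof.
move=> p q r; apply/fpsP => i; rewrite [RHS]fps_coef_mul_rev [LHS]/=.
pose c3 j k := fps_coef p j * (fps_coef q (i - j - k) * fps_coef r k).
transitivity (\sum_(j < i.+1) \sum_(k < i.+1 | (k <= i - j)%N) c3 j k).
  apply: eq_bigr => j _; rewrite -[X in _ * X]/(fps_coef (fps_mul q r) (i - j)).
  by rewrite fps_coef_mul_rev big_distrr /= (big_ord_narrow_leq (leq_subr _ _)).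
rewrite (exchange_big_dep predT) //=; apply: eq_bigr => k _.
transitivity (\sum_(j < i.+1 | (j <= i - k)%N) c3 j k).
  apply: eq_bigl => j; rewrite -ltnS -(ltnS j) -!subSn ?leq_ord //.
  by rewrite -subn_gt0 -(subn_gt0 j) -!subnDA addnC.
rewrite (big_ord_narrow_leq (leq_subr _ _)) big_distrl /=.
by apply: eq_bigr => j _; rewrite /c3 -!subnDA addnC mulrA.
Qed.

Fact fps_mul1 : left_id (fpsC 1) fps_mul.
Proof.
move=> f; apply/fpsP => n /=; rewrite big_ord_recl /= subn0 mul1r.
by rewrite big1 ?addr0 // => i _; rewrite /= mul0r.
Qed.

Fact fps_mulDl : left_distributive fps_mul +%R.
Proof.
move=> f g h; apply/fpsP => n /=; rewrite -big_split /=.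
by apply: eq_bigr => i _; rewrite mulrDl.
Qed.

Fact fps_1_neq0 : fpsC 1 != 0 :> {fps R}.
Proof.
by apply/eqP => /fpsP /(_ 0%N) /= /eqP; rewrite oner_eq0.
Qed.

HB.instance Definition _ := GRing.Zmodule_isComNzRing.Build {fps R}
  fps_mulA fps_mulC fps_mul1 fps_mulDl fps_1_neq0.

Lemma fps_coef1 n : fps_coef (1 : {fps R}) n = (n == 0%N)%:R.
Proof. by case: n. Qed.
Lemma fps_coefM f g n : fps_coef (f * g) n =
  \sum_(i < n.+1) fps_coef f i * fps_coef g (n - i).
Proof. by []. Qed.
Lemma fps_coef0M f g : fps_coef (f * g) 0 = fps_coef f 0 * fps_coef g 0.
Proof. by rewrite fps_coefM big_ord1. Qed.

End ComRing.

Definition fpsX (R : pzRingType) : {fps R} := FPS (fun n => (n == 1%N)%:R).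
Arguments fpsX {R}.

Definition map_fps (R S : Type) (phi : R -> S) (f : {fps R}) : {fps S} :=
  FPS (fun n => phi (fps_coef f n)).

Lemma map_fps_inj (R S : Type) (phi : R -> S) :
  injective phi -> injective (map_fps phi).
Proof. by move=> inj f g /fpsP H; apply/fpsP => n; apply/inj/(H n). Qed.

(* [cov_seq step n] lists the first n values of the sequence [cov step], each
   value being computed by [step] from the list of all the previous ones. *)
Section CourseOfValues.
Context (R : Type) (x0 : R) (step : seq R -> R).

Definition cov_seq n := iter n (fun s => rcons s (step s)) [::].
Definition cov n := step (cov_seq n).

Lemma size_cov_seq n : size (cov_seq n) = n.
Proof. by elim: n => //= n IH; rewrite size_rcons IH. Qed.

Lemma nth_cov_seq n i : (i < n)%N -> nth x0 (cov_seq n) i = cov i.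
Proof.
elim: n => //= n IH; rewrite ltnS leq_eqVlt nth_rcons size_cov_seq.
by case/predU1P => [->|lin]; rewrite ?ltnn ?eqxx // lin IH.
Qed.

End CourseOfValues.

Section ComUnitRing.
Context (R : comUnitRingType).
Implicit Types f g h : {fps R}.

Definition fps_unit : pred {fps R} := fun f => fps_coef f 0 \is a GRing.unit.

Definition fps_inv_step f (s : seq R) : R :=
  (fps_coef f 0)^-1 *
  ((size s == 0%N)%:R - \sum_(i < size s) s`_i * fps_coef f (size s - i)).

Definition fps_inv f : {fps R} :=
  if fps_unit f then FPS (cov (fps_inv_step f)) else f.

Fact fps_mulV : {in fps_unit, left_inverse 1 fps_inv *%R}.
Proof.
move=> f; rewrite unfold_in => Uf; apply/fpsP => n.
rewrite fps_coefM /fps_inv [fps_unit f]Uf /= big_ord_recr /= subnn.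
rewrite {2}/cov /fps_inv_step size_cov_seq mulrAC mulVr // mul1r.
under [X in _ - X]eq_bigr => i _ do rewrite (nth_cov_seq 0) //.
by rewrite addrC subrK; case: (n).
Qed.

Fact fps_unitP f g : g * f = 1 -> fps_unit f.
Proof.
move=> /fpsP /(_ 0%N); rewrite fps_coef0M fps_coef1 eqxx => gf1.
by apply/unitrPr; exists (fps_coef g 0); rewrite mulrC.
Qed.

Fact fps_inv_out : {in [predC fps_unit], fps_inv =1 id}.
Proof. by move=> f /negPf Uf; rewrite /fps_inv [fps_unit f]Uf. Qed.

HB.instance Definition _ := GRing.ComNzRing_hasMulInverse.Build {fps R}
  fps_mulV fps_unitP fps_inv_out.

Lemma fps_unitE f : (f \is a GRing.unit) = (fps_coef f 0 \is a GRing.unit).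
Proof. by []. Qed.

End ComUnitRing.

Section IntegralDomain.
Context (R : idomainType).

Fact fps_integral : GRing.integral_domain_axiom {fps R}.
Proof.
move=> f g fg0; apply/norP => -[f0 g0].
have nz (h : {fps R}) : h != 0 -> exists n, fps_coef h n != 0.
  move=> h0; apply: contrapT => H; case/eqP: h0; apply/fpsP => n.
  by apply/eqP; apply/negPn/negP => hn; apply: H; exists n.
case: (ex_minnP (nz _ f0)) => m fm minm; case: (ex_minnP (nz _ g0)) => n gn minn.
have /fpsP/(_ (m + n)%N) := fg0; rewrite fps_coefM fps_coef0.
have ltm : (m < (m + n).+1)%N by rewrite ltnS leq_addr.
rewrite (bigD1 (Ordinal ltm)) //= addKn big1 ?addr0.
  by move/eqP; rewrite mulf_eq0 (negPf fm) (negPf gn).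
move=> i /eqP nei; case: (ltngtP i m) => [lim|lmi|eim].
- have [->|/minm] := eqVneq (fps_coef f i) 0; first by rewrite mul0r.
  by rewrite leqNgt lim.
- have [->|/minn] := eqVneq (fps_coef g (m + n - i)) 0; first by rewrite mulr0.
  have lei : (i <= m + n)%N by rewrite -ltnS.
  by rewrite leqNgt ltn_subLR // ltn_add2r lmi.
- by case: nei; apply: val_inj.
Qed.

HB.instance Definition _ :=
  GRing.ComUnitRing_isIntegral.Build {fps R} fps_integral.

End IntegralDomain.

Section Sqrt.
Context (F : fieldType).
Implicit Types f g : {fps F}.

(* The square root of f with constant term 1, and 0 if there is none; it exists
   and is unique when f has constant term 1 and 2 is invertible, see
   [fps_sqrtP] and [fps_sqrt_uniq]. *)
Definition fps_sqrt f : {fps F} :=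
  xget 0 [set g | g ^+ 2 = f /\ fps_coef g 0 = 1]%classic.

Definition fps_sqrt_step f (s : seq F) : F :=
  if size s is n.+1 then
    (fps_coef f n.+1 - \sum_(i < n) s`_i.+1 * s`_(n - i)) / 2%:R
  else 1.

Lemma fps_sqrtP f : 2%:R != 0 :> F -> fps_coef f 0 = 1 ->
  fps_sqrt f ^+ 2 = f /\ fps_coef (fps_sqrt f) 0 = 1.
Proof.
move=> nz2 f0; apply: (@xgetPex _ 0 [set g | g ^+ 2 = f /\ fps_coef g 0 = 1]%classic).
exists (FPS (cov (fps_sqrt_step f))); split=> //; apply/fpsP => -[|n].
  by rewrite expr2 fps_coef0M /= mulr1 f0.
rewrite expr2 fps_coefM big_ord_recl big_ord_recr /=.
rewrite subn0 /bump /= add1n subnn [cov _ 0]/cov /= mul1r mulr1.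
set c := cov _ n.+1; set S2 := \sum_(i < n) _.
have -> : c = (fps_coef f n.+1 - S2) / 2%:R.
  rewrite /c /cov /fps_sqrt_step size_cov_seq; congr ((_ - _) / _).
  by apply: eq_bigr => i _; rewrite !(nth_cov_seq 0) ?ltnS ?leq_subr //.
by rewrite addrCA -mulr2n -[X in S2 + X]mulr_natr divfK // addrC subrK.
Qed.

Lemma fps_sqrt_uniq f g : 2%:R != 0 :> F ->
  g ^+ 2 = f -> fps_coef g 0 = 1 -> fps_sqrt f = g.
Proof.
move=> nz2 gf g0.
have f0 : fps_coef f 0 = 1 by rewrite -gf expr2 fps_coef0M g0 mulr1.
have [sf s0] := fps_sqrtP nz2 f0.
have /eqP : fps_sqrt f ^+ 2 = g ^+ 2 by rewrite sf gf.
rewrite eqf_sqr => /predU1P[//|/eqP /fpsP/(_ 0%N)].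
by rewrite fps_coefN s0 g0 => /eqP; rewrite -addr_eq0 -(natrD _ 1 1) (negPf nz2).
Qed.

End Sqrt.

(* [Black] and [Red] are the two kinds of down-steps. *)
Variant step := Up | Black | Red.

Definition step_code (s : step) : option bool :=
  match s with Up => None | Black => Some false | Red => Some true end.
Definition step_decode (o : option bool) : step :=
  match o with None => Up | Some false => Black | Some true => Red end.
Fact step_codeK : cancel step_code step_decode. Proof. by case. Qed.
HB.instance Definition _ := Finite.copy step (can_type step_codeK).

Definition rise (s : step) : int := if s == Up then 1 else -1.

Definition level (p : seq step) : int := \sum_(s <- p) rise s.

Definition can_follow : rel step := fun s t =>
  ~~ ((s == Up) && (t == Red)) && ~~ ((s == Red) && (t == Up)).

Definition decorated_dyck (p : seq step) : bool :=
  [forall k : 'I_(size p).+1, 0 <= level (take k p)] && sorted can_follow p.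

Definition dyck_count (n j : nat) : nat :=
  #|[set p : n.-tuple step | decorated_dyck p && (level p == j%:Z)]|.

(* Q[[z,u]] is rendered as Q[[z]][[u]]: the outer variable is u, the inner one
   is z. An expression such as r_1, which has a pole at z = 0, lives in the field
   Q((z)) = {fraction {fps rat}}; identities involving it are stated in
   Q((z))[[u]], into which Q[[z]][[u]] embeds by [map_fps tofrac]
   (see [map_fps_inj]). *)
Definition dyck_gf : {fps {fps rat}} :=
  FPS (fun j => FPS (fun n => (dyck_count n j)%:R)).

(* Main.v *)
Require Import Defs.
From mathcomp Require Import all_boot all_order all_algebra.
From mathcomp Require Import ring zify.
Import GRing.Theory.
Local Open Scope ring_scope.

Set Implicit Arguments.
Unset Strict Implicit.

Local Arguments fps_coef : simpl never.

(** Split the paths by their last step, the empty path counting as one that ends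
    with [Up]. Appending a step gives a linear recurrence for the three families
    of generating functions F_s,j(z). With w = 1 / r_1 = z v, it is solved by
    F_s,j = c_s w^j where c_Up = 1, c_Black = v - 1, c_Red = v - 1 - z^2 v,
    because w is the power series root of
    z - (1 + z^2) w + (2 z - z^3) w^2 = 0. *)

(** * Coefficients of products with [fpsX] and with constants *)

Lemma fps_coefXM0 (R : comNzRingType) (f : {fps R}) :
  fps_coef (fpsX * f) 0 = 0.
Proof. by rewrite fps_coef0M mul0r. Qed.

Lemma fps_coefXMS (R : comNzRingType) (f : {fps R}) n :
  fps_coef (fpsX * f) n.+1 = fps_coef f n.
Proof.
rewrite fps_coefM big_ord_recl big_ord_recl /= mul0r mul1r add0r subSS subn0.
by rewrite big1 ?addr0 // => i _; rewrite mul0r.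
Qed.

Lemma fps_coefCM (R : comNzRingType) (c : R) (f : {fps R}) n :
  fps_coef (fpsC c * f) n = c * fps_coef f n.
Proof.
rewrite fps_coefM big_ord_recl /= subn0.
by rewrite big1 ?addr0 // => i _; rewrite mul0r.
Qed.

Lemma fpsCV (F : fieldType) (c : F) : c != 0 -> (fpsC c)^-1 = fpsC c^-1.
Proof.
move=> nzc; have Uc : fpsC c \is a GRing.unit by rewrite fps_unitE unitfE.
apply: (mulrI Uc); rewrite mulrV //; apply/fpsP => n.
by rewrite fps_coefCM fps_coef1 /=; case: n => [|n] /=; rewrite ?mulfV ?mulr0.
Qed.

Lemma sum_tuple_rcons (V : nmodType) (T : finType) n (F : seq T -> V) :
  \sum_(p : n.+1.-tuple T) F p =
  \sum_(x : T) \sum_(p : n.-tuple T) F (rcons p x).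
Proof.
rewrite exchange_big pair_big /=.
pose h (q : n.-tuple T * T) : n.+1.-tuple T := [tuple of rcons q.1 q.2].
have inj_h : injective h.
  move=> [p x] [q y] /(congr1 val) /= /rcons_inj [epq ->].
  by rewrite (val_inj epq).
rewrite (reindex h) //; apply: onW_bij; apply: inj_card_bij => //.
by rewrite card_prod !card_tuple expnS mulnC.
Qed.

(** * Recurrence for decorated paths sorted by last step *)

Lemma level_rcons p t : level (rcons p t) = level p + rise t.
Proof. by rewrite /level -cats1 big_cat big_seq1. Qed.

Lemma decorated_dyck_level_ge0 p : decorated_dyck p -> 0 <= level p.
Proof. by case/andP=> /forallP/(_ ord_max) /=; rewrite take_size. Qed.

(* The default [Up] of [last] is harmless: from level 0 only [Up] is possible,
   and [can_follow Up Up] holds. *)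
Lemma decorated_dyck_rcons p t : decorated_dyck (rcons p t) =
  [&& decorated_dyck p, 0 <= level (rcons p t) & can_follow (last Up p) t].
Proof.
have takeE k : (k <= size p)%N -> take k (rcons p t) = take k p.
  by move=> lek; rewrite -cats1 takel_cat.
have levelE : [forall k : 'I_(size (rcons p t)).+1,
     0 <= level (take k (rcons p t))] =
   [forall k : 'I_(size p).+1, 0 <= level (take k p)] &&
   (0 <= level (rcons p t)).
  apply/forallP/andP => [H|[/forallP H H1] k].
    split; last by have := H ord_max; rewrite take_size.
    apply/forallP => k.
    have lek : (k < (size (rcons p t)).+1)%N.
      by rewrite size_rcons ltnS ltnW.
    by have := H (Ordinal lek); rewrite /= takeE // -ltnS.
  have [lek|ltk] := leqP k (size p).
    have ltk : (k < (size p).+1)%N by [].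
    by have := H (Ordinal ltk); rewrite /= takeE.
  by rewrite take_oversize //; apply: leq_trans ltk; rewrite size_rcons.
rewrite /decorated_dyck levelE.
case: p {takeE levelE} => [|x p]; last first.
  by rewrite rcons_cons /= rcons_path -!andbA; do !bool_congr; rewrite andbCA.
rewrite /= /level !big_seq1.
by case: t; rewrite /= ?andbT ?andbF.
Qed.

(** The level ranges over [int] so that the recurrence may ask for level -1, where the count is
    0. *)
Definition count_by_last (t : step) (n : nat) (l : int) : nat :=
  \sum_(p : n.-tuple step)
    [&& decorated_dyck p, level p == l & last Up p == t].

Lemma dyck_count_by_last n j :
  dyck_count n j = (\sum_t count_by_last t n j%:Z)%N.
Proof.
rewrite /dyck_count -sum1dep_card big_mkcond /= exchange_big /=.
apply: eq_bigr => p _; rewrite (bigD1 (last Up p)) //= eqxx andbT.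
rewrite big1 => [|t /negPf]; first by rewrite addn0; case: ifP.
by rewrite eq_sym => ->; rewrite !andbF.
Qed.

Lemma count_by_last0 t l : count_by_last t 0 l = (t == Up) && (l == 0).
Proof.
rewrite /count_by_last (big_pred1 [tuple]) => [|p]; last by rewrite [p]tuple0 /= eqxx.
rewrite /= /level big_nil (eq_sym 0 l) (eq_sym Up t) [X in nat_of_bool X]andbCA.
have -> : decorated_dyck [::].
  by rewrite /decorated_dyck andbT; apply/forallP => k; rewrite /level big_nil.
by rewrite /= andbC.
Qed.

Lemma count_by_last_lt0 t n l : l < 0 -> count_by_last t n l = 0%N.
Proof.
move=> l0; rewrite /count_by_last big1 // => p _.
case: (boolP (decorated_dyck p)) => //= /decorated_dyck_level_ge0 p0.
by case: eqP => // el; move: p0; rewrite el; lia.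
Qed.

(** Deleting the last step [t] leaves a decorated path on level [l - rise t] whose own last step may
    precede [t]. Conversely, appending [t] to such a path is legal because the new level [l] is
    nonnegative. *)
Lemma count_by_lastS t n l : 0 <= l -> count_by_last t n.+1 l =
  (\sum_(s | can_follow s t) count_by_last s n (l - rise t))%N.
Proof.
move=> l0; rewrite /count_by_last.
rewrite (sum_tuple_rcons n (fun p : seq step => nat_of_bool
  [&& decorated_dyck p, level p == l & last Up p == t])) /=.
rewrite (bigD1 t) //= [X in _ + X]big1 => [|s /negPf nst]; last first.
  by rewrite big1 // => p _; rewrite last_rcons nst !andbF.
rewrite addr0 exchange_big /=; apply: eq_bigr => p _.
rewrite last_rcons eqxx andbT decorated_dyck_rcons level_rcons.
(* For a fixed [p], only the summand with [s = last Up p] can be nonzero. *)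
rewrite big_mkcond (bigD1 (last Up p)) //= eqxx andbT big1 => [|s]; last first.
  by rewrite eq_sym => /negPf ->; rewrite !andbF if_same.
rewrite addn0 -[level p == _](inj_eq (addIr (rise t))) subrK.
by case: eqP => [->|_]; rewrite ?l0 ?andbF ?andbT; case: ifP; rewrite ?andbF ?andbT.
Qed.

(** * Generating functions by last step *)

Lemma sum_step (V : nmodType) (F : step -> V) :
  \sum_t F t = F Up + F Black + F Red.
Proof.
rewrite (bigD1 Up) // (bigD1 Black) // (bigD1 Red) //= big_pred0 => [|[]//].
by rewrite addr0 addrA.
Qed.

Definition last_weight (v : {fps rat}) (t : step) : {fps rat} :=
  match t with
  | Up => 1
  | Black => v - 1
  | Red => v - 1 - fpsX ^+ 2 * v
  end.

(** The hypothesis is the quadratic equation of w = z v with a factor z cancelled. Both sides agree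
    at length 0 and obey the same recurrence, so induction on [n], for all [t] and [j] at once,
    identifies them. *)
Lemma count_by_last_gf (v : {fps rat}) :
    1 - (1 + fpsX ^+ 2) * v + (2 * fpsX ^+ 2 - fpsX ^+ 4) * v ^+ 2 = 0 ->
  forall t n j, (count_by_last t n j%:Z)%:R =
                fps_coef (last_weight v t * (fpsX * v) ^+ j) n.
Proof.
move=> v_eq.
(* At z = 0 the equation reads 1 - v(0) = 0. Hence the weights of [Black] and [Red] vanish at z = 0,
   as the length 0 case demands. *)
have v0 : fps_coef v 0 = 1.
  have /(congr1 (fun f : {fps rat} => fps_coef f 0)) :
      1 - v + fpsX * (fpsX * ((2 - fpsX ^+ 2) * v ^+ 2 - v)) = 0.
    by rewrite -[RHS]v_eq; ring.
  rewrite fps_coefD fps_coefXM0 addr0 fps_coefB fps_coef1 => /eqP.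
  by rewrite subr_eq0 => /eqP.
move=> t n; elim: n t => [|n IHn] t j.
  rewrite count_by_last0 fps_coef0M.
  case: j => [|j]; last first.
    by rewrite andbF exprS -mulrA fps_coefXM0 mulr0.
  rewrite expr0 fps_coef1 mulr1 andbT.
  case: t; rewrite /last_weight ?fps_coef1 // fps_coefB.
    by rewrite v0 fps_coef1.
  by rewrite fps_coefB v0 fps_coef1 expr2 -mulrA fps_coefXM0.
rewrite count_by_lastS // natr_sum big_mkcond sum_step /=.
case: t => /=.
- case: j => [|j].
    (* An up-step ending on level 0 would start on level -1; on the other side, the series 1 has no
       term of positive degree. *)
    by rewrite !count_by_last_lt0 // expr0 mul1r fps_coef1 !addr0.
  have -> : j.+1%:Z - rise Up = j%:Z by rewrite /rise /=; lia.
  rewrite !IHn addr0 -fps_coefD -fps_coefXMS; congr fps_coef.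
  (* The weights of [Up] and [Black], the steps allowed before [Up], add up to v. *)
  by rewrite /= exprS; ring.
- have -> : j%:Z - rise Black = j.+1%:Z by rewrite /rise /=; lia.
  rewrite !IHn -!fps_coefD -fps_coefXMS; congr fps_coef.
  rewrite /= exprS; apply/eqP; rewrite -subr_eq0; apply/eqP.
  (* All three steps may precede [Black]: z w (2 v - 1 - z^2 v) - (v - 1) is exactly the quadratic
     expression in v. *)
  transitivity ((fpsX * v) ^+ j * (1 - (1 + fpsX ^+ 2) * v +
    (2 * fpsX ^+ 2 - fpsX ^+ 4) * v ^+ 2)); last by rewrite v_eq mulr0.
  by ring.
have -> : j%:Z - rise Red = j.+1%:Z by rewrite /rise /=; lia.
rewrite !IHn add0r -fps_coefD -fps_coefXMS; congr fps_coef.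
rewrite /= exprS; apply/eqP; rewrite -subr_eq0; apply/eqP.
(* With [Black] and [Red] as predecessors of [Red], the difference of the two sides is again w^j
   times the same quadratic expression. *)
transitivity ((fpsX * v) ^+ j * (1 - (1 + fpsX ^+ 2) * v +
  (2 * fpsX ^+ 2 - fpsX ^+ 4) * v ^+ 2)); last by rewrite v_eq mulr0.
by ring.
Qed.

Lemma dyck_gf_coef (v : {fps rat}) :
    1 - (1 + fpsX ^+ 2) * v + (2 * fpsX ^+ 2 - fpsX ^+ 4) * v ^+ 2 = 0 ->
  forall j, fps_coef dyck_gf j = (2 * v - 1 - fpsX ^+ 2 * v) * (fpsX * v) ^+ j.
Proof.
move=> v_eq j; apply/fpsP => n; transitivity ((dyck_count n j)%:R : rat) => //.
rewrite dyck_count_by_last natr_sum.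
under eq_bigr => t _ do rewrite (count_by_last_gf v_eq).
rewrite sum_step -!fps_coefD -!mulrDl; congr (fps_coef (_ * _) n).
by rewrite /=; ring.
Qed.

(** * Closed forms in terms of r_1 *)

Lemma weight_closed_form (F : fieldType) (z q : F) j :
    2 != 0 :> F -> z != 0 -> 1 + z ^+ 2 + q != 0 ->
  let v := 2 / (1 + z ^+ 2 + q) in
  (2 * v - 1 - z * z * v) * (z * v) ^+ j =
  (3 - 3 * z ^+ 2 - q) / (2 * z * ((1 + z ^+ 2 + q) / (2 * z)) ^+ j.+1).
Proof.
move=> nz2 nzz nze v; set r := _ / (2 * z).
have nzr : r != 0 by rewrite mulf_neq0 ?invr_eq0 ?mulf_neq0.
have -> : z * v = r^-1 by rewrite /r /v; field; rewrite nz2 nzz nze.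
(* Here 2 z r = 1 + z^2 + q is the denominator of [v], and the numerator is 4 - (1 + z^2 + q) - 2
   z^2. *)
have -> : 2 * v - 1 - z * z * v = (3 - 3 * z ^+ 2 - q) / (2 * z * r).
  by rewrite /r /v; field; rewrite nz2 nzz nze.
move: (_ - q) (2 * z) => c a.
by rewrite exprVn -mulrA -invfM -mulrA -exprS.
Qed.

(** The coefficients form a geometric progression of ratio 1/r, so multiplying by 1 - u/r cancels
    all of them except the constant one, c / (a r). *)
Lemma fps_geometric (F : fieldType) (S : {fps F}) (c a r : F) :
    a != 0 -> r != 0 -> (forall j, fps_coef S j = c / (a * r ^+ j.+1)) ->
  S = fpsC c / (fpsC (a * r) * (1 - fpsX / fpsC r)).
Proof.
move=> nza nzr coefE.
have UD : fpsC (a * r) * (1 - fpsX / fpsC r) \is a GRing.unit.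
  rewrite fps_unitE fps_coef0M fps_coefB fps_coef1 fps_coefXM0 subr0 mulr1.
  by rewrite unitfE mulf_neq0.
apply: (mulIr UD); rewrite divrK //; apply/fpsP => n.
rewrite mulrCA fps_coefCM fpsCV // mulrBr mulr1 fps_coefB mulrCA.
case: n => [|n].
  rewrite fps_coefXM0 subr0 coefE expr1 mulrC divfK //.
  by rewrite mulf_neq0.
rewrite fps_coefXMS mulrC [S * _]mulrC fps_coefCM !coefE.
rewrite [r ^+ n.+2]exprS [in RHS]/fps_coef /=.
have nzx : r ^+ n.+1 != 0 by rewrite expf_neq0.
by field; rewrite nzx nza.
Qed.

Theorem theorem1 :
  let K := {fraction {fps rat}} in
  let z : K := tofrac (fpsX : {fps rat}) in
  let u : {fps K} := fpsX in
  let sq : K :=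
    tofrac (fps_sqrt (1 - 6 * fpsX ^+ 2 + 5 * fpsX ^+ 4 : {fps rat})) in
  let r1 : K := (1 + z ^+ 2 + sq) / (2 * z) in
  let S_zu : {fps K} := map_fps (@tofrac {fps rat}) dyck_gf in
  S_zu = fpsC (3 - 3 * z ^+ 2 - sq) / (fpsC (2 * z * r1) * (1 - u / fpsC r1))
  /\ forall j : nat,
       fps_coef S_zu j = (3 - 3 * z ^+ 2 - sq) / (2 * z * r1 ^+ j.+1).
Proof.
move=> K z u sq r1 S_zu.
pose d : {fps rat} := 1 - 6 * fpsX ^+ 2 + 5 * fpsX ^+ 4.
have d0 : fps_coef d 0 = 1.
  have -> : d = 1 + fpsX * (5 * fpsX ^+ 3 - 6 * fpsX) by rewrite /d; ring.
  by rewrite fps_coefD fps_coefXM0 fps_coef1 addr0.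
have [s2 s0] := @fps_sqrtP rat d isT d0.
set s := fps_sqrt d in s2 s0.
(* [e] is 2 z r_1, which lies in Q[[z]] and has constant term 2. It is therefore invertible there,
   and v = 2 / e = 1 / (z r_1). *)
pose e : {fps rat} := 1 + fpsX ^+ 2 + s.
have Ue : e \is a GRing.unit.
  by rewrite fps_unitE unitfE !fps_coefD expr2 fps_coefXM0 s0 fps_coef1.
have [v ev] : exists v : {fps rat}, e * v = 2 by exists (2 / e); rewrite mulrCA mulrV ?mulr1.
have v_eq : 1 - (1 + fpsX ^+ 2) * v + (2 * fpsX ^+ 2 - fpsX ^+ 4) * v ^+ 2 = 0.
  (* Multiplying by e^2 and using e v = 2 turns the left side into e^2 - 2 (1 + z^2) e + 4 (2 z^2 -
     z^4), which expands to s^2 - d. *)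
  apply: (mulrI (unitrX 2 Ue)); rewrite mulr0.
  transitivity (e ^+ 2 - (1 + fpsX ^+ 2) * e * (e * v)
    + (2 * fpsX ^+ 2 - fpsX ^+ 4) * (e * v) ^+ 2); first by ring.
  rewrite ev; transitivity (s ^+ 2 - d); last by rewrite s2 subrr.
  by rewrite /e /d; ring.
have nz_z : z != 0.
  rewrite tofrac_eq0; apply/eqP => /fpsP/(_ 1%N).
  by rewrite fps_coef0.
have nz_2 : 2 != 0 :> K.
  rewrite -(rmorph_nat (@tofrac {fps rat})) tofrac_eq0.
  by apply/eqP => /fpsP/(_ 0%N).
have eE : tofrac e = 1 + z ^+ 2 + sq by rewrite /e !rmorphD rmorph1 rmorphXn.
have nz_e : 1 + z ^+ 2 + sq != 0.
  rewrite -eE tofrac_eq0; apply/eqP => e0.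
  by move: Ue; rewrite e0 unitr0.
have nz_r1 : r1 != 0 by rewrite mulf_neq0 ?invr_eq0 ?mulf_neq0.
have vE : tofrac v = 2 / (1 + z ^+ 2 + sq).
  apply: (mulfI nz_e); rewrite -{1}eE -rmorphM ev rmorph_nat.
  by rewrite mulrC divfK.
have coefE j : fps_coef S_zu j = (3 - 3 * z ^+ 2 - sq) / (2 * z * r1 ^+ j.+1).
  rewrite -[LHS]/(tofrac (fps_coef dyck_gf j)) (dyck_gf_coef v_eq).
  rewrite rmorphM rmorphXn !rmorphB !rmorphM.
  rewrite rmorph_nat rmorph1 /= vE -/z.
  exact: weight_closed_form.
split=> //; apply: fps_geometric => //; first by rewrite mulf_neq0.
Qed.
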